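(* Let $G=(V,E)$ be a strongly connected $d$-out digraph with period $\mathrm{per}(G)=t$, let $S$ be a coloring semigroup of $G$, and let $Q(G)$ be the quotient graph of $G$ induced by the stability classes of $S$. Then $\mathrm{per}(Q(G))=t$.
   Context: A $d$-out digraph has every vertex of out-degree $d$ (multiple edges allowed). A coloring is a decomposition of the adjacency matrix $\mathcal A=R_1+\cdots+R_d$ into 0-1 stochastic matrices, each identified with a map $V\to V$ ($jR_i=k$ iff $(R_i)_{jk}=1$; maps act on the right); the coloring semigroup $S$ is the semigroup they generate. The stability relation: $x\equiv_S y$ iff for every $W_1\in S$ there is $W_2\in S$ with $xW_1W_2=yW_1W_2$; it is a congruence (compatible with the colored edges). The quotient graph $Q(G)$ has as vertices the stability classes $[v]$, with an edge $[v]\to[w]$ for each edge $v\to w$ of $G$. The period $\mathrm{per}$ of a strongly connected digraph is the largest $t$ such that $V$ admits a partition $\{P_1,\ldots,P_t\}$ with every edge from $P_k$ ending in $P_{k+1}$ (indices mod $t$), equivalently the gcd of the lengths of its cycles; $\mathrm{per}=1$ means aperiodic. *)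

(* Defs.v *)
From mathcomp Require Import all_boot boolp.

Set Implicit Arguments.
Unset Strict Implicit.
Unset Printing Implicit Defensive.

(* A digraph with multiple edges on the vertex set V is given by its adjacency
   matrix A : V -> V -> nat, where A v w is the number of edges v -> w; matrices
   are indexed by V itself rather than by an enumeration of V. *)

Definition edge (V : finType) (A : V -> V -> nat) : rel V :=
  fun v w => 0 < A v w.

Definition out_regular (V : finType) (d : nat) (A : V -> V -> nat) : Prop :=
  forall v : V, \sum_(w : V) A v w = d.

Definition strongly_connected (V : finType) (A : V -> V -> nat) : Prop :=
  forall v w : V, connect (edge A) v w.

(* Injectivity of P makes the partition have exactly t blocks; [partition]
   requires them to be nonempty. [ordS] is the cyclic successor modulo t. *)
Definition cyclic_partition (V : finType) (A : V -> V -> nat) (t : nat)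
    (P : 'I_t -> {set V}) : Prop :=
  [/\ injective P,
      partition [set P k | k : 'I_t] [set: V]
    & forall (k : 'I_t) (v w : V), v \in P k -> edge A v w -> w \in P (ordS k)].

Definition has_cyclic_partition (V : finType) (A : V -> V -> nat) (t : nat)
    : Prop :=
  0 < t /\ exists P : 'I_t -> {set V}, cyclic_partition A P.

(* per(A) = t *)
Definition is_period (V : finType) (A : V -> V -> nat) (t : nat) : Prop :=
  has_cyclic_partition A t
  /\ forall s : nat, has_cyclic_partition A s -> s <= t.

Definition stochastic01 (V : finType) (M : V -> V -> nat) : Prop :=
  (forall j k : V, M j k <= 1) /\ (forall j : V, \sum_(k : V) M j k = 1).

Definition is_coloring (V : finType) (d : nat) (A : V -> V -> nat)
    (R : 'I_d -> V -> V -> nat) : Prop :=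
  (forall i : 'I_d, stochastic01 (R i))
  /\ (forall j k : V, A j k = \sum_(i < d) R i j k).

(* f is the map identified with the 0-1 stochastic matrix M. *)
Definition map_of_matrix (V : finType) (M : V -> V -> nat) (f : V -> V)
    : Prop :=
  forall j k : V, f j = k <-> M j k = 1.

(* The generated semigroup, without an added identity. Maps act on the right, so
   the product W1 W2 is the function W2 \o W1. *)
Inductive coloring_semigroup (V : finType) (d : nat)
    (R : 'I_d -> V -> V -> nat) : (V -> V) -> Prop :=
| Semigroup_gen (i : 'I_d) (f : V -> V) :
    map_of_matrix (R i) f -> coloring_semigroup R f
| Semigroup_mul (W1 W2 : V -> V) :
    coloring_semigroup R W1 -> coloring_semigroup R W2 ->
    coloring_semigroup R (W2 \o W1).

Definition stable (V : finType) (S : (V -> V) -> Prop) (x y : V) : Prop :=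
  forall W1 : V -> V, S W1 ->
  exists2 W2 : V -> V, S W2 & W2 (W1 x) = W2 (W1 y).

Definition stability_classes (V : finType) (S : (V -> V) -> Prop)
    : {set {set V}} :=
  equivalence_partition (fun x y : V => `[< stable S x y >]) [set: V].

Definition quotient_vertex (V : finType) (S : (V -> V) -> Prop) : finType :=
  {C : {set V} | C \in stability_classes S}.

(* One edge [v] -> [w] for each edge v -> w, counted with multiplicity. *)
Definition quotient_graph (V : finType) (A : V -> V -> nat)
    (S : (V -> V) -> Prop) (C D : quotient_vertex S) : nat :=
  \sum_(v in val C) \sum_(w in val D) A v w.

(* Main.v *)
Require Import Defs.
From mathcomp Require Import all_boot.
From mathcomp Require Import boolp.

(** A partition into [t] cyclically permuted blocks is the same thing as a
    surjective map [c : V -> Z/t] that increases by one along every edge. A word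
    of length [n] in the colors shifts [c] by [n], so two vertices that some word
    merges have the same value of [c]. Hence [c] is constant on stability classes
    and descends to the quotient graph. Conversely such a map on the quotient
    graph pulls back along [v |-> [v]]. So both graphs have cyclic partitions of
    exactly the same sizes. *)

Set Implicit Arguments.
Unset Strict Implicit.
Unset Printing Implicit Defensive.

(** Surjectivity says that the blocks, as fibres of [c], are nonempty; it also makes fibres over
    different labels different sets. *)
Definition cyclic_labelling (V : finType) (A : V -> V -> nat) (t : nat)
    (c : V -> 'I_t) : Prop :=
  (forall k, exists v, c v = k) /\ (forall v w, edge A v w -> c w = ordS (c v)).

Lemma cyclic_partition_labelling (V : finType) (A : V -> V -> nat) (t : nat) :
  (exists P : 'I_t -> {set V}, cyclic_partition A P) <->
  (exists c : V -> 'I_t, cyclic_labelling A c).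
Proof.
split=> [[P [injP /and3P[/eqP covP trivP n0P] edgeP]]|[c [surjc edgec]]].
  have /choice[c cP] : forall v, exists k, v \in P k.
    move=> v; have /bigcupP[B /imsetP[k _ ->] vPk] : v \in cover [set P k | k : 'I_t].
      by rewrite covP inE.
    by exists k.
  have c_uniq v k : v \in P k -> c v = k.
    move=> vPk; apply: injP; apply/eqP; apply: contraT => neqP.
    have /(_ _ _ (imset_f P isT) (imset_f P isT) neqP) := elimT trivIsetP trivP.
    by move=> /disjointFr/(_ (cP v)); rewrite vPk.
  exists c; split=> [k|v w /edgeP vw]; last exact/c_uniq/vw.
  have /set0Pn[v vPk] : P k != set0.
    by apply: contraNneq n0P => <-; apply: imset_f.
  by exists v; apply: c_uniq.
pose P k := [set v | c v == k].
have n0P k : exists v, v \in P k by have [v <-] := surjc k; exists v; rewrite inE.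
exists P; split=> [k l eqPkl||k v w].
- have [v vPk] := n0P k; move: (vPk); rewrite eqPkl !inE => /eqP <-.
  by move: vPk; rewrite inE => /eqP.
- apply/and3P; split.
  + apply/eqP/setP=> v; rewrite inE; apply/bigcupP.
    by exists (P (c v)); rewrite ?inE ?imset_f.
  + apply/trivIsetP=> _ _ /imsetP[k _ ->] /imsetP[l _ ->].
    apply: contraR => /pred0Pn[v /=]; rewrite !inE.
    by case/andP=> /eqP <- /eqP <-.
  + apply/imsetP=> -[k _ Pk0]; have [v] := n0P k.
    by rewrite -Pk0 inE.
- by rewrite !inE => /eqP <- /edgec ->.
Qed.

Section Stability.

Variables (V : finType) (S : (V -> V) -> Prop).

Lemma stable_refl x : stable S x x.
Proof. by move=> W SW; exists W. Qed.

Lemma stable_sym x y : stable S x y -> stable S y x.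
Proof. by move=> sxy W /sxy[W' SW' eqW]; exists W'. Qed.

Hypothesis mulS : forall W1 W2, S W1 -> S W2 -> S (W2 \o W1).

Lemma stable_trans x y z : stable S x y -> stable S y z -> stable S x z.
Proof.
move=> sxy syz W SW; have [W1 SW1 e1] := sxy W SW.
(* Stability of [y] and [z] is invoked for the longer word [W1 \o W], after which [x] and [y]
   already agree, so [W2] brings all three together. *)
have [W2 SW2 /= e2] := syz _ (mulS SW SW1).
by exists (W2 \o W1); rewrite /= ?e1 //; apply: mulS.
Qed.

Lemma stability_class_proof x :
  [set y in [set: V] | `[< stable S x y >]] \in stability_classes S.
Proof. by apply/imsetP; exists x; rewrite ?inE. Qed.

Definition stability_class x : quotient_vertex S :=
  exist (fun C => C \in stability_classes S) _ (stability_class_proof x).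

Lemma mem_stability_class x y : y \in val (stability_class x) <-> stable S x y.
Proof. by rewrite !inE /=; split=> /asboolP. Qed.

Lemma stability_class_eq x y :
  stable S x y <-> stability_class x = stability_class y.
Proof.
split=> [sxy|exy]; last first.
  by rewrite -mem_stability_class exy; apply/mem_stability_class/stable_refl.
apply/val_inj/setP=> z; apply/idP/idP => /mem_stability_class s;
  apply/mem_stability_class; apply: stable_trans s => //.
exact: stable_sym.
Qed.

Lemma stability_class_of_mem x (C : quotient_vertex S) :
  x \in val C -> C = stability_class x.
Proof.
case: C => C CS /= xC; have /imsetP[y _ defC] := CS.
have -> : exist _ C CS = stability_class y by apply: val_inj.
by apply/stability_class_eq/mem_stability_class; rewrite /= -defC.
Qed.

Lemma stability_class_surj (C : quotient_vertex S) : exists x, stability_class x = C.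
Proof.
case: C => C CS; have /imsetP[y _ defC] := CS.
by exists y; apply: val_inj.
Qed.

Lemma edge_quotient_graph (A : V -> V -> nat) (C D : quotient_vertex S) :
  edge (@quotient_graph V A S) C D <->
  exists v w, [/\ stability_class v = C, stability_class w = D & edge A v w].
Proof.
rewrite /edge /quotient_graph; split.
  rewrite lt0n sum_nat_eq0 negb_forall => /existsP[v].
  rewrite negb_imply sum_nat_eq0 negb_forall => /andP[vC /existsP[w]].
  rewrite negb_imply -lt0n => /andP[wD vw].
  by exists v, w; split=> //; apply/esym/stability_class_of_mem.
case=> v [w [<- <- vw]].
have mem x : x \in val (stability_class x).
  exact/mem_stability_class/stable_refl.
by rewrite (bigD1 v) //= (bigD1 w) //= -addnA ltn_addr.
Qed.

(** A labelling descends through a choice of class representatives, which is harmless because labels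
    are constant on classes; it lifts back by composition with [stability_class]. *)
Lemma cyclic_labelling_quotient (A : V -> V -> nat) (t : nat) :
  (forall c : V -> 'I_t, cyclic_labelling A c ->
    forall x y, stable S x y -> c x = c y) ->
  (exists c, cyclic_labelling A (t := t) c) <->
  (exists c, cyclic_labelling (@quotient_graph V A S) (t := t) c).
Proof.
move=> c_stable; split=> [[c cA]|[c [surjc edgec]]].
  have /choice[r rK] := stability_class_surj.
  have cr v : c (r (stability_class v)) = c v.
    by apply: c_stable cA _ _ _; apply/stability_class_eq; rewrite rK.
  exists (c \o r); case: cA => surjc edgec; split=> [k|C D] /=.
    by have [v <-] := surjc k; exists (stability_class v).
  by case/edge_quotient_graph=> v [w [<- <- /edgec]]; rewrite !cr.
exists (c \o stability_class); split=> [k|v w vw] /=.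
  have [C <-] := surjc k; have [v <-] := stability_class_surj C.
  by exists v.
by apply/edgec/edge_quotient_graph; exists v, w.
Qed.

End Stability.

Section Coloring.

Variables (V : finType) (d : nat) (A : V -> V -> nat) (R : 'I_d -> V -> V -> nat).
Hypothesis colR : is_coloring A R.

(** The number [n] is the length of a word for [W]. What matters is that it is the same for all
    [v]. *)
Lemma coloring_semigroup_shift t (c : V -> 'I_t) W :
  cyclic_labelling A c -> coloring_semigroup R W ->
  exists n, forall v, c (W v) = iter n (@ordS t) (c v).
Proof.
move=> [_ edgec]; elim=> {W} [i f fR|W1 W2 _ [n1 e1] _ [n2 e2]].
  (* Color [i] contributes 1 to [A v (f v)], so [f] moves each vertex along an edge. *)
  exists 1 => v; apply: edgec; rewrite /edge colR.2 (bigD1 i) //=.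
  by rewrite (elimT eqP (introT eqP (proj1 (fR v (f v)) erefl))).
by exists (n2 + n1) => v; rewrite /= e2 e1 iterD.
Qed.

Lemma coloring_map_exists i : exists f, map_of_matrix (R i) f.
Proof.
have [le1R sum1R] := colR.1 i.
have /choice[f fP] : forall j, exists k, R i j k = 1 /\ forall l, R i j l = 1 -> k = l.
  move=> j; have := eqxx 1; rewrite -{1}(sum1R j) => /sum_nat_eq1[k [_ Rk R0]].
  exists k; split=> // l Rl; apply/esym/eqP; apply: contraT => neq.
  by move: (R0 l neq isT); rewrite Rl.
by exists f => j k; split=> [<-|]; [exact: (fP j).1 | exact: (fP j).2].
Qed.

(** Stability is vacuous over an empty semigroup, as for [d = 0], so a merging word can only be
    extracted once some element is known. Any edge carries a color, hence gives one. *)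
Lemma coloring_semigroup_nonempty v w :
  edge A v w -> exists W, coloring_semigroup R W.
Proof.
rewrite /edge colR.2 lt0n sum_nat_eq0 negb_forall => /existsP[i _].
by have [f fR] := coloring_map_exists i; exists f; apply: Semigroup_gen fR.
Qed.

Lemma cyclic_labelling_stable t (c : V -> 'I_t) x y :
  strongly_connected A -> cyclic_labelling A c ->
  stable (coloring_semigroup R) x y -> c x = c y.
Proof.
(* The empty path means [x = y]; otherwise the first edge of the path provides an element of the
   semigroup. *)
move=> connA cA sxy; have /connectP[[|z p] /=] := connA x y; first by move=> _ ->.
case/andP=> /coloring_semigroup_nonempty[W1 SW1] _ _.
have [W2 SW2 eW] := sxy _ SW1.
have [n en] := coloring_semigroup_shift cA (Semigroup_mul SW1 SW2).
(* The merging word shifts both labels by the same [n], and [ordS] is injective, so the shift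
   cancels. *)
have : iter n (@ordS t) (c x) = iter n (@ordS t) (c y) by rewrite -!en /= eW.
by elim: n {en} => //= n IHn /ordS_inj.
Qed.

End Coloring.

Theorem mainTheorem5 (V : finType) (d : nat) (A : V -> V -> nat)
    (R : 'I_d -> V -> V -> nat) (t : nat)
    (hd : out_regular d A)
    (hconn : strongly_connected A)
    (hper : is_period A t)
    (hcol : is_coloring A R) :
  is_period (@quotient_graph V A (coloring_semigroup R)) t.
Proof.
have same_sizes s : has_cyclic_partition A s <->
    has_cyclic_partition (@quotient_graph V A (coloring_semigroup R)) s.
  rewrite /has_cyclic_partition !cyclic_partition_labelling.
  (* What remains is closure under products and constancy of labellings on stability classes. *)
  rewrite (cyclic_labelling_quotient (S := coloring_semigroup R)) //.
    exact: Semigroup_mul.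
  by move=> c cA x y; apply: (cyclic_labelling_stable hcol).
case: hper => ht tmax; split; first exact/same_sizes.
by move=> s /same_sizes; apply: tmax.
Qed.
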